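(* Let $G$ be a finite group. If $N\unlhd G$, then $\alpha(G)\le\alpha(G/N)$. Moreover, $\alpha(G)=\alpha(G/N)$ if and only if $\varphi(o(g))=\varphi(o(gN))$ for every $g\in G$, where $o(gN)$ denotes the order of the element $gN$ in the group $G/N$.
   Context: For a finite group $H$, $c(H)$ denotes the number of cyclic subgroups of $H$ (including the trivial one) and $\alpha(H):=c(H)/|H|$. $o(g)$ denotes the order of $g$ and $\varphi$ is Euler's totient function. *)

(* Defs.v *)
From mathcomp Require Import all_boot all_order all_fingroup all_algebra all_solvable.

Set Implicit Arguments.
Unset Strict Implicit.
Unset Printing Implicit Defensive.

Import GroupScope GRing.Theory.

Definition num_cyclic_subgroups (gT : finGroupType) (H : {group gT}) : nat :=
  #|[set C in subgroups H | cyclic C]|.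

Definition alpha (gT : finGroupType) (H : {group gT}) : rat :=
  ((num_cyclic_subgroups H)%:R / #|H|%:R)%R.

(* Main.v *)
Require Import Defs.
From mathcomp Require Import all_boot all_order all_fingroup all_algebra all_solvable.

Import GroupScope.

(** A cyclic group of order [n] has [totient n] generators, so giving each
    element [g] of [H] the weight [1 / totient #[g]] spreads a total weight of
    exactly 1 over the generators of each cyclic subgroup
    ([num_cyclic_subgroups_sum]).  Hence [alpha H] is the mean over [H] of the
    weights.  As the cosets of [N] all have the same size, [alpha (G / N)] is
    also a mean over [G], that of [1 / totient #[coset N g]]
    ([alpha_quotient_mean]).  Now [#[coset N g]] divides [#[g]] and [totient] is
    monotone for divisibility ([totient_dvdn_leq]), so the two means compare term
    by term, and they are equal exactly when all the terms are. *)

(** In the product formula for [totient], the factors at the primes of [m] can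
    only grow from [m] to [n], and the factors at the other primes of [n] are
    positive. *)
Lemma totient_dvdn_leq (m n : nat) :
  (0 < n)%N -> m %| n -> (totient m <= totient n)%N.
Proof.
move=> n_gt0 dvd_mn; have m_gt0 := dvdn_gt0 n_gt0 dvd_mn.
have primes_mn p : p \in primes m -> p \in primes n.
  rewrite !mem_primes m_gt0 n_gt0 => /andP[-> /= dvd_pm].
  exact: dvdn_trans dvd_pm dvd_mn.
have perm_primes : perm_eq (primes m) [seq p <- primes n | p \in primes m].
  apply: uniq_perm; rewrite ?filter_uniq ?primes_uniq // => p.
  by rewrite mem_filter; case: (boolP (p \in primes m)) => //= /primes_mn ->.
rewrite !totientE // (perm_big _ perm_primes) big_filter big_mkcond /=.
rewrite big_seq [X in (_ <= X)%N]big_seq.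
apply: (big_ind2 leq) => // [a b c d | p pr_n]; first exact: leq_mul.
have p_pr : prime p by move: pr_n; rewrite mem_primes => /andP[].
have p_gt0 := prime_gt0 p_pr.
case: ifP => _; last by rewrite muln_gt0 -subn1 subn_gt0 prime_gt1 // expn_gt0 p_gt0.
rewrite leq_mul2l leq_pexp2l ?orbT // -!subn1 leq_sub2r //.
exact: dvdn_leq_log.
Qed.

Lemma num_cyclic_subgroups_sum (gT : finGroupType) (H : {group gT}) :
  ((num_cyclic_subgroups H)%:R = \sum_(g in H) (totient #[g])%:R^-1 :> rat)%R.
Proof.
rewrite (partition_big (fun g => <[g]>%G)
           (mem [set C in subgroups H | cyclic C])) /=; last first.
  by move=> g gH; rewrite !inE cycle_subG gH cycle_cyclic.
rewrite /num_cyclic_subgroups -sum1_card GRing.natr_sum.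
apply: eq_bigr => C; rewrite !inE => /andP[sCH /cyclicP[x defC]].
rewrite (eq_bigr (fun=> (totient #[x])%:R^-1)%R); last first.
  by move=> g /andP[_ /eqP/(congr1 val)/= defg]; rewrite !orderE defg defC.
rewrite GRing.sumr_const (_ : #|_| = totient #[x]).
  by rewrite -[RHS]GRing.mulr_natr GRing.mulVf // Num.Theory.pnatr_eq0 -lt0n
             totient_gt0 order_gt0.
rewrite totient_gen; apply: eq_card => g.
rewrite unfold_in inE /generator -defC.
apply/andP/eqP=> [[_ /eqP <-] // | defg].
have defCg : <[g]>%G = C by apply: val_inj; rewrite /= -defg.
by split; [rewrite -cycle_subG -defg | apply/eqP].
Qed.

(** The fibres of [coset N] over [G / N] are cosets of [N]. *)
Lemma sum_quotient (R : nmodType) (gT : finGroupType) (G N : {group gT})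
    (f : coset_of N -> R) :
  N <| G ->
  (\sum_(g in G) f (coset N g) = (\sum_(x in (G / N)%g) f x) *+ #|N|)%R.
Proof.
move=> /andP[sNG nNG].
rewrite (partition_big (coset N) (mem (G / N))) /=; last first.
  by move=> g gG; apply: mem_quotient.
rewrite -GRing.sumrMnl; apply: eq_bigr => _ /morphimP[y nNy yG ->].
rewrite (eq_bigr (fun=> f (coset N y))); last by move=> g /andP[_ /eqP->].
rewrite GRing.sumr_const -(card_rcoset N y); congr (_ *+ _)%R.
apply: eq_card => g; apply/andP/idP=> [[gG /eqP eq_gy] | Nyg].
  by apply/(rcoset_kercosetP (subsetP nNG g gG) nNy).
have gG : g \in G.
  by case/rcosetP: Nyg => n nN ->; exact: groupM (subsetP sNG n nN) yG.
by split=> //; apply/eqP/(rcoset_kercosetP (subsetP nNG g gG) nNy).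
Qed.

Lemma alpha_quotient_mean (gT : finGroupType) (G N : {group gT}) :
  N <| G ->
  (alpha (G / N)%G
   = (\sum_(g in G) (totient #[coset N g])%:R^-1) / #|G|%:R)%R.
Proof.
move=> nsNG; rewrite /alpha num_cyclic_subgroups_sum.
rewrite (@sum_quotient _ _ _ _ (fun x => (totient #[x])%:R^-1)%R nsNG).
have cardG : #|G| = (#|N| * #|G / N|)%N.
  by rewrite card_quotient ?normal_norm // Lagrange ?normal_sub.
rewrite -[X in (_ = X / _)%R]GRing.mulr_natl cardG GRing.natrM -GRing.mulf_div GRing.mulfV ?GRing.mul1r //.
by rewrite Num.Theory.pnatr_eq0 -lt0n cardG_gt0.
Qed.

Theorem mainTheorem15 (gT : finGroupType) (G N : {group gT}) (nNG : N <| G) :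
  (alpha G <= alpha (G / N)%G)%R /\
  (alpha G = alpha (G / N)%G <->
   forall g : gT, g \in G -> totient #[g] = totient #[coset N g]).
Proof.
have cardG_gt0R : (0 < #|G|%:R^-1 :> rat)%R.
  by rewrite Num.Theory.invr_gt0 Num.Theory.ltr0n cardG_gt0.
have le_term g : g \in G ->
  ((totient #[g])%:R^-1 <= ((totient #[coset N g])%:R^-1 : rat)
     ?= iff (totient #[g] == totient #[coset N g]))%R.
  move=> gG; split; last first.
    by rewrite (inj_eq GRing.invr_inj) Num.Theory.eqr_nat.
  rewrite Num.Theory.lef_pV2 ?Num.Theory.posrE ?Num.Theory.ltr0n
    ?totient_gt0 ?order_gt0 // Num.Theory.ler_nat.
  apply: totient_dvdn_leq => //.
  exact: morph_order (subsetP (normal_norm nNG) g gG).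
have [le_sum eq_sum] := Num.Theory.leif_sum le_term.
rewrite alpha_quotient_mean // /alpha num_cyclic_subgroups_sum.
split; first by rewrite Num.Theory.ler_pM2r.
split=> [/(GRing.mulIf (Num.Theory.lt0r_neq0 cardG_gt0R)) eq_means g gG | eq_tot].
  move/eqP: eq_means; rewrite eq_sum => /forall_inP/(_ g gG)/eqP; exact.
congr (_ / _)%R; apply/eqP; rewrite eq_sum.
by apply/forall_inP=> g gG; apply/eqP/eq_tot.
Qed.
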